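(* Let $K/k$ be a separable field extension of degree $6$ and $\widetilde{K}/k$ its Galois closure. (1) If $[\widetilde{K}:k]=24$ or $[\widetilde{K}:k]>36$, then $K/k$ is not Hopf Galois. (2) If $\operatorname{Gal}(\widetilde{K}/k)\simeq A_4$, then $K/k$ is not Hopf Galois.
   Context: A finite extension of fields $L/k$ is called Hopf Galois if there exists a finite cocommutative $k$-Hopf algebra $H$ such that $L$ is an $H$-module algebra and the $k$-linear map $j: L\otimes_k H\to \operatorname{End}_k(L)$, $j(s\otimes h)(t)=s(ht)$ for $h\in H$, $s,t\in L$, is bijective. *)

(* Defs.v *)
From HB Require Import structures.
From mathcomp Require Import all_boot all_order all_algebra.
From mathcomp Require Import all_fingroup all_solvable all_field.
Set Implicit Arguments.
Unset Strict Implicit.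
Unset Printing Implicit Defensive.
Import GRing.Theory.
Local Open Scope ring_scope.

(* Tensor products of finite-dimensional vector spaces.  V (x) W is realised  *)
(* as the space of coefficient matrices with respect to the chosen bases      *)
(* vbasis {:V} and vbasis {:W}; tens v w is the pure tensor v (x) w, and      *)
(* tlift b is the linear map out of V (x) W induced by b : V -> W -> U, which *)
(* is meaningful when b is bilinear (lemmas tlift_tens and tens_ext give the  *)
(* universal property).  In particular, tlift (fun a b => F a b) (Delta h) is *)
(* the Sweedler sum of the F h_(1) h_(2).                                     *)
Section Tensor.
Variable k : fieldType.

Definition tensor (V W : vectType k) : vectType k :=
  'M[k]_(\dim {:V}, \dim {:W}).

Definition tens (V W : vectType k) (v : V) (w : W) : tensor V W :=
  \matrix_(i, j) (coord (vbasis {:V}) i v * coord (vbasis {:W}) j w).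

Definition tlift (V W U : vectType k) (b : V -> W -> U) (t : tensor V W) : U :=
  \sum_(i < \dim {:V}) \sum_(j < \dim {:W})
    (t : 'M_(_, _)) i j *: b (vbasis {:V})`_i (vbasis {:W})`_j.

Lemma tlift_tens (V W U : vectType k) (b : 'Hom(V, 'Hom(W, U)))
    (v : V) (w : W) :
  tlift (fun x y => b x y) (tens v w) = b v w.
Proof.
rewrite [in RHS](coord_vbasis (memvf v)) linear_sum sum_lfunE.
apply: eq_bigr => i _; rewrite linearZ lfunE /=.
rewrite [in RHS](coord_vbasis (memvf w)) linear_sum scaler_sumr.
apply: eq_bigr => j _.
by rewrite mxE linearZ scalerA.
Qed.

Lemma tens_ext (V W U : vectType k) (f g : 'Hom(tensor V W, U)) :
  (forall v w, f (tens v w) = g (tens v w)) -> f = g.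
Proof.
move=> eq_fg; apply/lfunP => /= t.
rewrite (matrix_sum_delta (t : 'M_(_, _))) !linear_sum; apply: eq_bigr => i _.
rewrite !linear_sum; apply: eq_bigr => j _; rewrite !linearZ /=.
suff -> : delta_mx i j = tens (vbasis {:V})`_i (vbasis {:W})`_j;
  first by rewrite eq_fg.
apply/matrixP => i' j'; rewrite !mxE.
rewrite !coord_free ?(basis_free (vbasisP _)) //.
by rewrite -natrM mulnb (eq_sym i) (eq_sym j).
Qed.

End Tensor.

Section HopfAlgebra.
Variable k : fieldType.

Definition tens_mul (A : falgType k) (x y : tensor A A) : tensor A A :=
  tlift (fun a b => tlift (fun c d => tens (a * c) (b * d)) y) x.

Definition tens_swap (V : vectType k) : tensor V V -> tensor V V :=
  tlift (fun a b => tens b a).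

(* A falgType has a unit element 1 <> 0, which is no restriction here since   *)
(* the counit sends 1 to 1.                                                   *)
Record hopf_algebra (H : falgType k) := HopfAlgebra {
  comul : 'Hom(H, tensor H H);
  counit : 'Hom(H, k^o);
  antipode : 'End(H);
  (* (id (x) Delta) Delta = (Delta (x) id) Delta, after reassociation *)
  comulA : forall h : H,
    tlift (fun a b => tlift (fun c d => tens a (tens c d)) (comul b)) (comul h)
    = tlift (fun a b => tlift (fun c d => tens c (tens d b)) (comul a))
        (comul h);
  counitl : forall h : H, tlift (fun a b => counit a *: b) (comul h) = h;
  counitr : forall h : H, tlift (fun a b => counit b *: a) (comul h) = h;
  comul1 : comul 1 = tens 1 1;
  comulM : forall g h : H, comul (g * h) = tens_mul (comul g) (comul h);
  counit1 : counit 1 = 1;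
  counitM : forall g h : H, counit (g * h) = counit g * counit h;
  antipodel : forall h : H,
    tlift (fun a b => antipode a * b) (comul h) = counit h *: 1;
  antipoder : forall h : H,
    tlift (fun a b => a * antipode b) (comul h) = counit h *: 1
}.

Definition cocommutative (H : falgType k) (hopfH : hopf_algebra H) : Prop :=
  forall h : H, tens_swap (comul hopfH h) = comul hopfH h.

(* act h t stands for the action h t of H on A. *)
Record module_algebra (H : falgType k) (hopfH : hopf_algebra H)
    (A : falgType k) (act : 'Hom(H, 'End(A))) : Prop := ModuleAlgebra {
  act1 : forall t : A, act 1 t = t;
  actM : forall (g h : H) (t : A), act (g * h) t = act g (act h t);
  act_one : forall h : H, act h 1 = counit hopfH h *: 1;
  act_mul : forall (h : H) (s t : A),
    act h (s * t) = tlift (fun a b => act a s * act b t) (comul hopfH h)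
}.

(* amull s is the endomorphism t |-> s * t of L. *)
Definition galois_map (H : falgType k) (L : fieldExtType k)
    (act : 'Hom(H, 'End(L))) : tensor L H -> 'End(L) :=
  tlift (fun (s : L) (h : H) => (amull s \o act h)%VF).

Definition hopf_galois (L : fieldExtType k) : Prop :=
  exists (H : falgType k) (hopfH : hopf_algebra H) (act : 'Hom(H, 'End(L))),
    [/\ cocommutative hopfH,
        module_algebra hopfH act
      & bijective (galois_map act)].

End HopfAlgebra.

(* N, together with the k-embedding iota of K, is a Galois closure of K/k:    *)
(* N/k is Galois and no proper subextension Galois over k contains iota(K).   *)
Definition galois_closure (k : fieldType) (K : fieldExtType k)
    (N : splittingFieldType k) (iota : 'AHom(K, N)) : Prop :=
  galois 1 {:N} /\
  forall E : {subfield N},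
    (limg iota <= E)%VS -> galois 1 E -> E = {:N}%AS.

(* Main.v *)
Require Import Defs.
From HB Require Import structures.
From mathcomp Require Import all_boot all_order all_algebra.
From mathcomp Require Import all_fingroup all_solvable all_field.

(* Let L be the Galois closure, G its group, and X the set of embeddings of K *)
(* in L.  By Dedekind's lemma the action of a Hopf algebra H on K is encoded  *)
(* by functions c x y : H -> L with x (h t) = \sum_y c x y h * y t.  For a    *)
(* fixed x, the Hopf Galois condition makes the c x y an L-basis of the       *)
(* convolution algebra Hom(H, L), made of orthogonal idempotents; so the set  *)
(* of these functions does not depend on x, and the permutations s of X for   *)
(* which c x (s x) is independent of x form a regular group N, normalised by  *)
(* G (the Greither-Pareigis group).  When |X| = 6, the Sylow 3-subgroup P of  *)
(* N is normalised by G and has two orbits, exchanged by G, so G has a        *)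
(* subgroup G0 of index 2.  The centraliser of P in G0 has exponent 3, hence  *)
(* order dividing 9, and index at most 2 in G0: |G| divides 36.  Finally, A_4 *)
(* has no subgroup of index 2.                                                *)

(** The embeddings behave like a group in which [c x y] is the quotient of y by x. Bijectivity of
    the Galois map makes the [c x y], for fixed x, a basis ([act_coef_free], [act_coef_span]), and
    the module algebra law makes them orthogonal idempotents ([conv_act_coef]), so all x give the
    same set of functions ([act_coef_onto]). Associativity of the action yields the quotient rule
    [act_coef_div], and Galois automorphisms respect equalities between the [c x y]
    ([act_coef_gal]). These facts give the regular group of [hopf_galois_regular]. In degree 6,
    [regular_six_normalizer] bounds any transitive group normalising it. The orders excluded in (1)
    do not divide 36, and [index2_Alt4] excludes A_4. *)

Set Implicit Arguments.
Unset Strict Implicit.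
Unset Printing Implicit Defensive.

(** * Group theory *)

Section StablePerms.
Local Open Scope group_scope.
Variables (X : finType) (T : eqType) (c : X -> X -> T).

(** The model is a group X with [c x y] equal to x^-1 y: the stable permutations are then the right
    translations, and the hypothesis [c_div] below is the identity y^-1 z = (x^-1 y)^-1 (x^-1 z). *)
Definition stable_perms : {set {perm X}} :=
  [set s : {perm X} | [forall x, forall y, c x (s x) == c y (s y)]].

Lemma stable_permsP (s : {perm X}) :
  reflect (forall x y, c x (s x) = c y (s y)) (s \in stable_perms).
Proof.
rewrite inE; apply: (iffP forallP) => [cs x y | cs x].
  by have /forallP/(_ y)/eqP := cs x.
by apply/forallP => y; apply/eqP.
Qed.

Hypothesis c_onto : forall x x' y', exists y, c x y = c x' y'.
Hypothesis c_inj : forall x, injective (c x).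
Hypothesis c_diag : forall x y, c x x = c y y.
Hypothesis c_div : forall x y z x' y' z',
  c x y = c x' y' -> c x z = c x' z' -> c y z = c y' z'.

Lemma stable_perms_group : group_set stable_perms.
Proof.
apply/group_setP; split=> [|s t /stable_permsP cs /stable_permsP ct].
  by apply/stable_permsP => x y; rewrite !perm1.
apply/stable_permsP => x y; rewrite !permM.
by apply: (@c_div (s x) _ _ (s y)) => //; apply: (@c_div x _ _ y).
Qed.
Canonical stable_perms_groupType := Group stable_perms_group.

Lemma stable_perms_eq (s t : {perm X}) x :
  s \in stable_perms -> t \in stable_perms -> s x = t x -> s = t.
Proof.
move=> /stable_permsP cs /stable_permsP ct st; apply/permP => y.
by apply: (@c_inj y); rewrite (cs y x) (ct y x) st.
Qed.

Lemma stable_perms_ex x y : exists2 s, s \in stable_perms & s x = y.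
Proof.
have ex x' : exists y', c x' y' == c x y.
  by have [y' <-] := c_onto x' x y; exists y'.
(* The translation taking x to y sends each x' to the point having the same quotient by x' as y has
   by x. *)
pose f x' := xchoose (ex x').
have fE x' : c x' (f x') = c x y by apply/eqP/(xchooseP (ex x')).
have f_inj : injective f.
  move=> a b fab; apply: (@c_inj (f a)).
  rewrite [in RHS]fab.
  by apply: (@c_div a _ _ b); rewrite ?fE //; apply: c_diag.
exists (perm f_inj); last by rewrite permE; apply: (@c_inj x); rewrite fE.
by apply/stable_permsP => a b; rewrite !permE !fE.
Qed.

Lemma stable_perms_trans (x0 : X) : [transitive stable_perms, on setT | 'P].
Proof.
apply/imsetP; exists x0; rewrite ?inE //; apply/setP => y; rewrite inE.
have [s sN <-] := stable_perms_ex x0 y.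
by symmetry; apply/orbitP; exists s.
Qed.

Lemma stable_perms_stab x : 'C_stable_perms[x | 'P] = 1.
Proof.
apply/trivgP/subsetP => s /setIP[sN /astab1P sx]; rewrite inE.
apply/eqP/(@stable_perms_eq _ _ x); rewrite ?group1 ?perm1 //; exact: sx.
Qed.

Lemma stable_perms_norm (g : {perm X}) :
  (forall x y x' y', c x y = c x' y' -> c (g x) (g y) = c (g x') (g y')) ->
  g \in 'N(stable_perms).
Proof.
move=> cg; rewrite inE; apply/subsetP => _ /imsetP[s /stable_permsP cs ->].
apply/stable_permsP => x y.
have e z : (s ^ g) z = g (s (g^-1 z)) by rewrite -{1}[z](permKV g) permJ.
rewrite !e -{1}[x](permKV g) -{1}[y](permKV g); exact: cg.
Qed.

End StablePerms.

Section IndexTwo.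
Local Open Scope group_scope.

(* A nontrivial normal subgroup of the primitive group A_4 is transitive, so   *)
(* its order is divisible by 4.                                                *)
Lemma index2_Alt4 (H : {group {perm 'I_4}}) :
  H \subset 'Alt_('I_4) -> #|'Alt_('I_4) : H| != 2.
Proof.
move=> sHA; apply/eqP => i2.
have nH : H <| 'Alt_('I_4) by apply: index2_normal.
have cA : #|'Alt_('I_4)| = 12.
  have := @card_Alt 'I_4; rewrite card_ord => /(_ isT) /(f_equal half).
  by rewrite mul2n doubleK.
have cH : #|H| = 6.
  have /eqP := Lagrange sHA.
  by rewrite i2 cA -[12]/(6 * 2)%N eqn_pmul2r // => /eqP.
have tr2 : [transitive^2 'Alt_('I_4), on setT | 'P].
  by have := Alt_trans 'I_4; rewrite card_ord.
have pr := ntransitive_primitive (isT : 1 < 2) tr2.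
case: (prim_trans_norm pr nH) => [sHC|trH].
  have := subset_trans sHC (aperm_faithful _).
  by move/subset_leq_card; rewrite cards1 cH.
by have := atrans_dvd trH; rewrite cardsT card_ord cH.
Qed.

End IndexTwo.

(** * Normalisers of regular groups of degree 6 *)

Section DegreeSix.
Local Open Scope group_scope.
Variables (X : finType) (N G : {group {perm X}}).
Hypothesis cardX : #|X| = 6.
Hypothesis N_trans : [transitive N, on setT | 'P].
Hypothesis N_stab : forall x, 'C_N[x | 'P] = 1.
Hypothesis G_trans : [transitive G, on setT | 'P].
Hypothesis nNG : G \subset 'N(N).

Lemma card_regular_six : #|N| = 6.
Proof.
have /card_gt0P[x _] : 0 < #|X| by rewrite cardX.
have := card_orbit_stab 'P N x; rewrite N_stab cards1 muln1.
by rewrite (atransP N_trans) ?inE // cardsT cardX.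
Qed.

(** The 3-core is characteristic in N, so whatever normalises N normalises P. It is the Sylow
    3-subgroup because the latter has index 2, hence is normal. *)
Let P := 'O_3(N).

Lemma core3_Sylow : 3.-Sylow(N) P.
Proof.
have [Q sylQ] := Sylow_exists 3 N.
have cQ : #|Q| = 3 by rewrite (card_Hall sylQ) card_regular_six p_part.
have nQ : Q <| N.
  apply: index2_normal; first exact: pHall_sub sylQ.
  have /eqP := Lagrange (pHall_sub sylQ).
  by rewrite cQ card_regular_six -[6]/(3 * 2)%N eqn_pmul2l // => /eqP.
by rewrite /P (normal_Hall_pcore sylQ nQ).
Qed.

Lemma card_core3 : #|P| = 3.
Proof. by rewrite (card_Hall core3_Sylow) card_regular_six p_part. Qed.

Lemma core3_stab x : 'C_P[x | 'P] = 1.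
Proof. by apply/trivgP; rewrite -(N_stab x) setSI ?pcore_sub. Qed.

Lemma core3_norm : G \subset 'N(P).
Proof. by rewrite (char_norm_trans (pcore_char 3 N)) ?nNG. Qed.

Lemma card_core3_orbit x : #|orbit 'P P x| = 3.
Proof. by rewrite card_orbit core3_stab indexg1 card_core3. Qed.

Let S := orbit 'P P @: setT.

Lemma card_core3_orbits : #|S| = 2.
Proof.
have pS : partition S setT.
  by apply: orbit_partition; apply/actsP => a _ x; rewrite !inE.
have uS : {in S, forall A : {set X}, #|A| = 3}.
  by move=> _ /imsetP[x _ ->]; apply: card_core3_orbit.
have := card_uniform_partition uS pS; rewrite cardsT cardX => h.
by apply/eqP; rewrite -(eqn_pmul2r (isT : 0 < 3)) -h.
Qed.

Lemma core3_orbit_act g x :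
  g \in G -> 'P^*%act (orbit 'P P x) g = orbit 'P P (g x).
Proof.
move=> /(subsetP core3_norm) nPg.
by apply: etrans (setact_orbit _ _ _ _) _; rewrite (normP nPg).
Qed.

Lemma core3_orbits_trans : [transitive G, on S | 'P^*].
Proof.
have /card_gt0P[x _] : 0 < #|X| by rewrite cardX.
apply/imsetP; exists (orbit 'P P x); first by rewrite imset_f ?inE.
apply/setP=> A; apply/imsetP/orbitP => [[y _ ->] | [g gG <-]].
  have [g gG ->] := atransP2 G_trans (in_setT x) (in_setT y).
  by exists g; rewrite ?core3_orbit_act.
by exists (g x); rewrite ?core3_orbit_act ?inE.
Qed.

(* c preserves both orbits of P, hence acts on each of them as an element of P. *)
Lemma cent_core3_exp3 x c :
  c \in 'C_('C_G[orbit 'P P x | 'P^*])(P) -> c ^+ 3 = 1.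
Proof.
case/setIP=> /setIP[cG /astab1P cx] cP.
have cE : orbit 'P P (c x) = orbit 'P P x by rewrite -core3_orbit_act.
have cO y : orbit 'P P (c y) = orbit 'P P y.
  have [e|nxy] := eqVneq (orbit 'P P x) (orbit 'P P y).
    by rewrite -core3_orbit_act // -e.
  have nxcy : orbit 'P P x != orbit 'P P (c y).
    by rewrite -cE -!core3_orbit_act // (inj_eq (act_inj _ _)).
  (* Otherwise the orbits of x, y and [c y] would be three distinct ones, while there are only
     two. *)
  apply/eqP; apply: contraTT isT => ncy.
  have: #|[set orbit 'P P x; orbit 'P P y; orbit 'P P (c y)]| <= #|S|.
    apply/subset_leq_card/subsetP => A; rewrite !inE.
    by case/orP=> [/orP[]|] /eqP ->; rewrite imset_f ?inE.
  rewrite card_core3_orbits -setUA cardsU1 cards2 !inE negb_or nxy nxcy /=.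
  by rewrite eq_sym ncy.
apply/permP => y; rewrite perm1.
(* Since c commutes with p and agrees with it at y, the cube of c agrees at y with the cube of p,
   which is 1. *)
have /orbitP[p pP py] : c y \in orbit 'P P y by rewrite -cO orbit_refl.
have cp z : c (p z) = p (c z) by rewrite -!permM (centP cP p pP).
have p3 : p ^+ 3 = 1 by rewrite -card_core3 expg_cardG.
have py' : c y = p y by rewrite -py.
rewrite !expgS expg0 mulg1 !permM py' cp py' !cp py' -[LHS]/(p (p (p y))).
by rewrite -!permM -[LHS]/((p ^+ 3) y) p3 perm1.
Qed.

Lemma regular_six_normalizer :
  (exists2 H : {group {perm X}}, H \subset G & #|G : H| = 2) /\ #|G| %| 36.
Proof.
have /card_gt0P[x _] : 0 < #|X| by rewrite cardX.
pose A := orbit 'P P x; pose G0 := 'C_G[A | 'P^*]%G.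
have AS : A \in S by rewrite imset_f ?inE.
have sG0 : G0 \subset G by apply: subsetIl.
have iG0 : #|G : G0| = 2.
  by rewrite -card_orbit (atransP core3_orbits_trans _ AS) card_core3_orbits.
split; first by exists G0.
pose C := 'C_G0(P)%G.
have C3 : 3.-group C.
  rewrite -pnat_exponent; apply: (@pnat_dvd _ 3) => //.
  by apply/exponentP => c; apply: cent_core3_exp3.
have cC : #|C| %| 9.
  (* The order of the symmetric group on X is 720, whose 3-part is 9. *)
  have dC : #|C| %| 720.
    have sC : C \subset 'Sym_X by apply/subsetP => s _; rewrite inE.
    by have := cardSg sC; rewrite card_Sym cardX.
  have [i ci] := p_natP C3; move: dC; rewrite ci.
  case: i {ci} => [|[|[|i]]] //.
  rewrite (_ : i.+3 = (3 + i)%N) // expnD.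
  by move=> /(dvdn_trans (dvdn_mulr _ (dvdnn _))).
have iC : #|G0 : C| %| 2.
  (* The index of the centraliser is the size of the [G0]-class of a generator of P, which lies
     among the two nontrivial elements of P. *)
  have /cyclicP[s Ps] : cyclic P by rewrite prime_cyclic ?card_core3.
  rewrite /C /= Ps cent_cycle index_cent1.
  have sP : s ^: G0 \subset P :\ 1.
    apply/subsetP => _ /imsetP[g gG0 ->]; rewrite !inE conjg_eq1 memJ_norm.
      rewrite Ps cycle_id andbT -cycle_eq1 -Ps -cardG_gt1 card_core3 //.
    by apply: (subsetP core3_norm); apply: (subsetP sG0).
  have cP1 : #|P^#| = 2 by have := cardsD1 1 P; rewrite group1 card_core3 => -[].
  have := subset_leq_card sP; rewrite cP1.
  have : 0 < #|s ^: G0|.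
    by rewrite card_gt0; apply/set0Pn; exists s; apply: class_refl.
  by case: #|_ | => [|[|[|]]].
rewrite -(Lagrange sG0) iG0 -(Lagrange (subsetIl G0 'C(P))).
by rewrite mulnC (_ : 36 = 2 * (2 * 9))%N // dvdn_mul // mulnC dvdn_mul.
Qed.

End DegreeSix.

Import GRing.Theory.
Local Open Scope ring_scope.

(** * The coefficients of a Hopf algebra action on the embeddings *)

(** Dedekind's independence of characters, by induction on the number of nonzero coefficients. *)
Lemma rmorphism_independent (K L : fieldType) (I : finType)
    (f : I -> {rmorphism K -> L}) (a : I -> L) :
    (forall i j, f i =1 f j -> i = j) ->
  (forall t, \sum_i a i * f i t = 0) -> forall i, a i = 0.
Proof.
move=> f_inj; have [m] := ubnP #|[pred i | a i != 0]|.
elim: m a => // m IHm a lt_a_m sum0 i; apply/eqP/negPn/negP => ai_nz.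
have f_eq j : a j != 0 -> j = i.
  move=> aj_nz; apply: f_inj => s.
  suffices /eqP: a j * (f j s - f i s) = 0.
    by rewrite mulf_eq0 (negPf aj_nz) subr_eq0 => /eqP.
  (* The relation at [s * t] minus [f i s] times the relation at t is a relation without the i-th
     term. *)
  apply: (IHm (fun j => a j * (f j s - f i s))) => [|t].
    rewrite -ltnS; apply: leq_trans lt_a_m; rewrite ltnS; apply: proper_card.
    apply/properP; split; last by exists i; rewrite ?inE //= subrr mulr0 eqxx.
    by apply/subsetP => l; rewrite !inE mulf_eq0 negb_or => /andP[].
  transitivity (\sum_l a l * f l (s * t) - f i s * \sum_l a l * f l t).
    rewrite mulr_sumr -sumrB; apply: eq_bigr => l _.
    by rewrite rmorphM mulrBr mulrBl mulrA [f i s * _]mulrCA mulrA.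
  by rewrite !sum0 mulr0 subrr.
have := sum0 1; rewrite (bigD1 i) //= big1 ?addr0 => [|j ne_ji].
  by rewrite rmorph1 mulr1 => a0; rewrite a0 eqxx in ai_nz.
by have [->|/f_eq ej] := eqVneq (a j) 0; rewrite ?mul0r // ej eqxx in ne_ji *.
Qed.

Section Coefficients.
Variables (k : fieldType) (K L : fieldExtType k).
Local Notation n := (\dim {:K}).
Local Notation b := (vbasis {:K}).
Variable emb : 'I_n -> 'AHom(K, L).
Hypothesis emb_inj : injective emb.

Lemma emb_coef_uniq (a a' : 'I_n -> L) :
  (forall t, \sum_y a y * emb y t = \sum_y a' y * emb y t) -> a =1 a'.
Proof.
move=> eq_aa' y; apply/eqP; rewrite -subr_eq0; apply/eqP.
apply: (@rmorphism_independent K L _ (fun y => emb y) (fun y => a y - a' y)).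
  by move=> i j eq_ij; apply/emb_inj/val_inj/lfunP.
by move=> t; under eq_bigr => z _ do rewrite mulrBl; rewrite sumrB eq_aa' subrr.
Qed.

Definition emb_mx : 'M[L]_n := \matrix_(y, i) emb y b`_i.

Lemma emb_mx_unit : emb_mx \in unitmx.
Proof.
rewrite -row_free_unit; apply: inj_row_free => v v0; apply/rowP => y.
rewrite mxE; move: y; apply: emb_coef_uniq => t.
rewrite [RHS]big1 => [|y _]; last by rewrite mul0r.
rewrite (coord_vbasis (memvf t)).
under eq_bigr => y _ do rewrite linear_sum mulr_sumr.
rewrite exchange_big big1 // => i _.
have /rowP/(_ i) := v0; rewrite !mxE => v0i.
under eq_bigr => y _ do rewrite linearZ /= -scalerAr.
rewrite -scaler_sumr -[RHS](scaler0 _ (coord b i t)); congr (_ *: _).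
by rewrite -[RHS]v0i; apply: eq_bigr => y _; rewrite mxE.
Qed.

(** As many embeddings as the degree form an L-basis of ['Hom(K, L)]; these are the coordinates of T
    in it, found by inverting [emb_mx]. *)
Definition emb_coef (T : 'Hom(K, L)) (y : 'I_n) : L :=
  \sum_(i < n) T b`_i * invmx emb_mx i y.

Lemma emb_coefP (T : 'Hom(K, L)) t : T t = \sum_y emb_coef T y * emb y t.
Proof.
pose r : 'rV[L]_n := \row_i T b`_i.
have rE y : emb_coef T y = (r *m invmx emb_mx) 0 y.
  by rewrite mxE; apply: eq_bigr => i _; rewrite mxE.
rewrite [in LHS](coord_vbasis (memvf t)) [in RHS](coord_vbasis (memvf t)).
under [RHS]eq_bigr => y _ do rewrite linear_sum mulr_sumr.
rewrite exchange_big linear_sum; apply: eq_bigr => i _ /=.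
rewrite linearZ; under eq_bigr => y _ do rewrite linearZ /= -scalerAr.
rewrite -scaler_sumr; congr (_ *: _).
have /rowP/(_ i) := mulmxKV emb_mx_unit r; rewrite mxE [RHS]mxE => e.
by apply: etrans (esym e) _; apply: eq_bigr => y _; rewrite rE [emb_mx y i]mxE.
Qed.

Lemma emb_coef_linear y : linear (emb_coef^~ y).
Proof.
move=> a T U; rewrite /emb_coef scaler_sumr -big_split; apply: eq_bigr => i _ /=.
by rewrite add_lfunE scale_lfunE mulrDl scalerAl.
Qed.

(** * Coefficients of the action and their convolution *)

Variables (H : falgType k) (hopfH : hopf_algebra H) (act : 'Hom(H, 'End(K))).
Hypothesis modH : module_algebra hopfH act.
Local Notation hb := (vbasis {:H}).

Definition act_coef_fun x y (h : H) : L := emb_coef (emb x \o act h)%VF y.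

Lemma act_coef_is_linear x y : linear (act_coef_fun x y).
Proof.
move=> a g h; rewrite /act_coef_fun linearP comp_lfunDr -comp_lfunZr.
exact: emb_coef_linear.
Qed.
HB.instance Definition _ x y :=
  GRing.isLinear.Build k H L _ (act_coef_fun x y) (@act_coef_is_linear x y).

Definition act_coef x y : 'Hom(H, L) := linfun (act_coef_fun x y).
Local Notation c := act_coef.

Lemma act_coefP x h t : emb x (act h t) = \sum_y c x y h * emb y t.
Proof.
rewrite -[LHS](@comp_lfunE _ _ _ _ (emb x) (act h)) emb_coefP.
by apply: eq_bigr => y _; rewrite lfunE.
Qed.

Lemma act_coef1 x y : c x y 1 = (x == y)%:R.
Proof.
move: y; apply: emb_coef_uniq => t; rewrite -act_coefP (Defs.act1 modH).
rewrite (bigD1 x) //= eqxx mul1r big1 ?addr0 // => y.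
by rewrite eq_sym => /negPf->; rewrite mul0r.
Qed.

(** The matrices of the [c x y h] represent H over L: expand the action of g, then that of h. *)
Lemma act_coefM x z g h : c x z (g * h) = \sum_y c x y g * c y z h.
Proof.
move: z; apply: emb_coef_uniq => t; rewrite -act_coefP (Defs.actM modH) act_coefP.
under eq_bigr => y _ do rewrite act_coefP mulr_sumr.
rewrite exchange_big; apply: eq_bigr => z _; rewrite mulr_suml.
by apply: eq_bigr => y _; rewrite mulrA.
Qed.

Definition conv (f g : H -> L) (h : H) : L :=
  tlift (fun a b => f a * g b) (comul hopfH h).

(** Expand the image under x of [act h (s * t)] in two ways, by the module algebra law and by
    multiplicativity of the embeddings, then compare coefficients in t and in s. *)
Lemma conv_act_coef x y z h : conv (c x y) (c x z) h = c x z h *+ (y == z).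
Proof.
have convE s t : emb x (act h (s * t)) =
    \sum_z (\sum_y conv (c x y) (c x z) h * emb y s) * emb z t.
  rewrite (act_mul modH) /tlift linear_sum.
  under eq_bigr => i _ do [rewrite linear_sum;
    under eq_bigr => j _ do
      rewrite linearZ rmorphM /= !act_coefP big_distrlr /= scaler_sumr].
  under [RHS]eq_bigr => z' _ do rewrite mulr_suml.
  under [RHS]eq_bigr => z' _ do under eq_bigr => y' _ do
    rewrite /conv /tlift !mulr_suml.
  under eq_bigr => i _ do rewrite exchange_big /=.
  rewrite exchange_big [RHS]exchange_big /=; apply: eq_bigr => y' _.
  rewrite [RHS]exchange_big /=; apply: eq_bigr => i _.
  under eq_bigr => j _ do rewrite scaler_sumr.
  rewrite exchange_big /=; apply: eq_bigr => z' _.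
  rewrite !mulr_suml; apply: eq_bigr => j _.
  by rewrite -!scalerAl mulrACA mulrA.
have {}convE s : forall z,
    \sum_y conv (c x y) (c x z) h * emb y s = c x z h * emb z s.
  apply: emb_coef_uniq => t; rewrite -convE act_coefP.
  by apply: eq_bigr => z' _; rewrite rmorphM mulrA.
move: y; apply: emb_coef_uniq => s; rewrite convE.
rewrite (bigD1 z) //= eqxx mulr1n big1 ?addr0 // => y /negPf->.
by rewrite mulr0n mul0r.
Qed.

(** * Consequences of the bijectivity of the Galois map *)

Hypothesis gal_bij : bijective (galois_map act).

(* Surjectivity of the Galois map is only used on the rank one endomorphisms  *)
(* t |-> (i-th coordinate of t) *: 1.                                         *)
Lemma act_coef_free x (a : 'I_n -> L) :
  (forall h, \sum_y a y * c x y h = 0) -> forall y, a y = 0.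
Proof.
move=> a0.
(* Every T comes from the Galois map, so its coefficient vector is an L-combination of vectors of
   values of the [c x y], and a is orthogonal to all of these. *)
have factor (T : 'End(K)) : exists2 e : 'I_n -> L,
    forall t, emb x (T t) = \sum_y e y * emb y t & \sum_y a y * e y = 0.
  have [g _ gK] := gal_bij; rewrite -(gK T) /galois_map /tlift.
  set M := g T.
  exists (fun y => \sum_i \sum_j (M : 'M_(_, _)) i j *: (emb x b`_i * c x y hb`_j)).
    move=> t; rewrite sum_lfunE linear_sum.
    under [RHS]eq_bigr => y _ do rewrite mulr_suml.
    rewrite [RHS]exchange_big; apply: eq_bigr => i _ /=.
    rewrite sum_lfunE linear_sum.
    under [RHS]eq_bigr => y _ do rewrite mulr_suml.
    rewrite [RHS]exchange_big; apply: eq_bigr => j _ /=.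
    rewrite scale_lfunE linearZ comp_lfunE lfunE rmorphM /= act_coefP.
    rewrite mulr_sumr scaler_sumr.
    by apply: eq_bigr => y _; rewrite -scalerAl mulrA.
  under eq_bigr => y _ do rewrite mulr_sumr.
  rewrite exchange_big big1 // => i _.
  under eq_bigr => y _ do rewrite mulr_sumr.
  rewrite exchange_big big1 // => j _ /=.
  under eq_bigr => y _ do rewrite -scalerAr mulrCA.
  by rewrite -scaler_sumr -mulr_sumr a0 mulr0 scaler0.
(* Write a as [emb_mx] times w. Pairing a with the coefficients of the i-th rank one endomorphism
   returns the i-th entry of w. *)
pose u : 'cV[L]_n := \col_y a y; pose w := invmx emb_mx *m u.
have w0 : w = 0.
  apply/colP => i; rewrite [RHS]mxE.
  have lin : linear (fun t => coord b i t *: 1 : K).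
    by move=> l s t /=; rewrite linearP scalerDl scalerA.
  pose T : {linear K -> K} :=
    HB.pack (fun t => coord b i t *: 1 : K) (GRing.isLinear.Build k K K *:%R _ lin).
  have [e eE ae] := factor (linfun T).
  rewrite -[RHS]ae.
  have uE y : a y = \sum_j emb_mx y j * w j 0.
    by have /colP/(_ y) := mulKVmx emb_mx_unit u; rewrite [RHS]mxE => <-; rewrite mxE.
  under [RHS]eq_bigr => y _ do rewrite uE mulr_suml.
  rewrite exchange_big (bigD1 i) //= [X in _ = _ + X]big1 ?addr0 => [|j ne_ji].
    under eq_bigr => y _ do rewrite [emb_mx y i]mxE mulrAC [_ * e y]mulrC.
    rewrite -mulr_suml -eE lfunE /= coord_free ?(basis_free (vbasisP _)) //.
    by rewrite eqxx scale1r rmorph1 mul1r.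
  under eq_bigr => y _ do rewrite [emb_mx y j]mxE mulrAC [_ * e y]mulrC.
  rewrite -mulr_suml -eE lfunE /= coord_free ?(basis_free (vbasisP _)) //.
  by rewrite (negPf ne_ji) scale0r linear0 mul0r.
move=> y; have := mulKVmx emb_mx_unit u; rewrite -/w w0 mulmx0 => /colP/(_ y).
by rewrite !mxE.
Qed.

Lemma galois_map_linear : linear (galois_map act).
Proof.
move=> a s t; rewrite /galois_map /tlift scaler_sumr -big_split; apply: eq_bigr => i _.
rewrite scaler_sumr -big_split; apply: eq_bigr => j _ /=.
by rewrite !mxE scalerDl scalerA.
Qed.
HB.instance Definition _ :=
  GRing.isLinear.Build k (tensor K H) 'End(K) *:%R (galois_map act) galois_map_linear.

(** Injectivity of the Galois map bounds n times the dimension of H by that of ['End(K)], which is n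
    squared. *)
Lemma dim_hopf_le : (\dim {:H} <= n)%N.
Proof.
have [g gK _] := gal_bij; pose f := linfun (galois_map act).
have f_inj : lker f == 0%VS.
  by apply/lker0P => s t; rewrite !lfunE; apply: can_inj gK _ _.
have := dimvS (subvf (limg f)); rewrite limg_dim_eq; last first.
  by rewrite (eqP f_inj) capv0.
have -> : \dim {: tensor K H} = (n * \dim {:H})%N by rewrite dimvf dim_matrix.
have -> : \dim {: 'End(K)} = (n * n)%N by rewrite !dimvf.
by rewrite leq_pmul2l // adim_gt0.
Qed.

Lemma act_coef_span x (f : 'Hom(H, L)) :
  exists a : 'I_n -> L, forall h, f h = \sum_y a y * c x y h.
Proof.
pose C : 'M[L]_(n, \dim {:H}) := \matrix_(y, j) c x y hb`_j.
have C_free : row_free C.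
  apply: inj_row_free => v v0; apply/rowP => y; rewrite [RHS]mxE.
  move: y; apply: (act_coef_free (x := x)) => h.
  rewrite (coord_vbasis (memvf h)).
  under eq_bigr => y _ do rewrite linear_sum mulr_sumr.
  rewrite exchange_big big1 // => j _.
  under eq_bigr => y _ do rewrite linearZ -scalerAr.
  rewrite -scaler_sumr -[RHS](scaler0 _ (coord hb j h)); congr (_ *: _).
  have /rowP/(_ j) := v0; rewrite mxE [RHS]mxE => e.
  by rewrite -[RHS]e; apply: eq_bigr => y _; rewrite mxE.
have C_full : row_full C.
  by rewrite /row_full eqn_leq rank_leq_col (eqP C_free) dim_hopf_le.
pose r : 'rV[L]_(\dim {:H}) := \row_j f hb`_j.
have /submxP[a rE] := submx_full r C_full.
exists (fun y => a 0 y) => h.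
rewrite (coord_vbasis (memvf h)) linear_sum.
under [RHS]eq_bigr => y _ do rewrite linear_sum mulr_sumr.
rewrite [RHS]exchange_big; apply: eq_bigr => j _ /=.
under [RHS]eq_bigr => y _ do rewrite linearZ -scalerAr.
rewrite linearZ -scaler_sumr; congr (_ *: _).
have /rowP/(_ j) := rE; rewrite mxE [RHS]mxE => e.
by apply: etrans e _; apply: eq_bigr => y _; rewrite mxE.
Qed.

Lemma act_coef_inj x : injective (c x).
Proof.
move=> y z eq_yz; apply/eqP/negPn/negP => ne_yz.
have /(_ y) : forall w, (w == y)%:R - (w == z)%:R = 0 :> L.
  apply: (act_coef_free (x := x)) => h.
  under eq_bigr => w _ do rewrite mulrBl.
  rewrite sumrB (bigD1 y) //= [X in _ - X](bigD1 z) //= !eqxx !mul1r eq_yz.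
  by rewrite !big1 ?addr0 ?subrr // => w /negPf->; rewrite mul0r.
by rewrite eqxx (negPf ne_yz) subr0 => /eqP; rewrite oner_eq0.
Qed.

(* Orthogonal idempotents which form a basis of the convolution algebra are   *)
(* exactly its primitive idempotents, whatever x they were built from.        *)
Lemma act_coef_onto x x' y' : exists y, c x y = c x' y'.
Proof.
have /fin_all_exists[A AE] := fun z => act_coef_span x (c x' z).
(* In the basis [c x y] convolution is coordinatewise, so the coordinate vectors [A z] are
   orthogonal idempotents of L^n. *)
have convA z z' : forall y, A z y * A z' y = A z y *+ (z == z').
  suffices e : forall y, A z y * A z' y - A z y *+ (z == z') = 0.
    by move=> y; apply/eqP; rewrite -subr_eq0 e.
  apply: (act_coef_free (x := x)) => h.
  under eq_bigr => y _ do rewrite mulrBl mulrnAl.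
  rewrite sumrB sumrMnl -AE; apply/eqP; rewrite subr_eq0; apply/eqP.
  transitivity (c x' z' h *+ (z == z')); last by case: eqP => [->|_].
  rewrite -conv_act_coef /conv /tlift.
  under [RHS]eq_bigr => i _ do under eq_bigr => j _ do
    rewrite !AE big_distrlr /= scaler_sumr.
  under [RHS]eq_bigr => i _ do rewrite exchange_big.
  rewrite [RHS]exchange_big; apply: eq_bigr => y _ /=.
  transitivity (\sum_w A z y * A z' w * conv (c x y) (c x w) h).
    rewrite (bigD1 y) //= conv_act_coef eqxx mulr1n big1 ?addr0 // => w.
    by rewrite eq_sym conv_act_coef => /negPf->; rewrite mulr0.
  under [RHS]eq_bigr => i _ do under eq_bigr => j _ do rewrite scaler_sumr.
  under [RHS]eq_bigr => i _ do rewrite exchange_big.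
  rewrite [RHS]exchange_big; apply: eq_bigr => w _ /=.
  rewrite /conv /tlift mulr_sumr; apply: eq_bigr => i _.
  rewrite mulr_sumr; apply: eq_bigr => j _.
  by rewrite -scalerAr mulrACA.
have A_nz z : exists y, A z y != 0.
  apply/existsP; rewrite -negb_forall; apply/negP => /forallP A0.
  have /(_ z) : forall y, (y == z)%:R = 0 :> L.
    apply: (act_coef_free (x := x')) => h.
    rewrite (bigD1 z) //= eqxx mul1r AE !big1 ?addr0 // => y.
      by move=> /negPf->; rewrite mul0r.
    by rewrite (eqP (A0 y)) mul0r.
  by rewrite eqxx => /eqP; rewrite oner_eq0.
have /fin_all_exists[p p_nz] := A_nz.
(* Orthogonal vectors have disjoint supports. There are n nonzero ones, so each support is a single
   point, where the value is 1. *)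
have p_inj : injective p.
  move=> z z' eq_p; apply/eqP/negPn/negP => ne_zz'.
  have := convA z z' (p z); rewrite (negPf ne_zz') => /eqP.
  by rewrite mulf_eq0 (negPf (p_nz z)) eq_p (negPf (p_nz z')).
exists (p y'); apply/lfunP => h.
rewrite AE (bigD1 (p y')) //= big1 ?addr0 => [|y ne_y].
  have := convA y' y' (p y'); rewrite eqxx -[RHS]mulr1 => /(mulfI (p_nz _))->.
  by rewrite mul1r.
have [q pK qK] := injF_bij p_inj; have := convA y' (q y) y.
have [e|_] := eqVneq y' (q y); first by rewrite e qK eqxx in ne_y.
move/eqP; rewrite mulf_eq0 => /orP[/eqP->|]; first by rewrite mul0r.
by rewrite -{2}(qK y) (negPf (p_nz _)).
Qed.

Lemma act_coef_diag x x' : c x x = c x' x'.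
Proof.
have [y e] := act_coef_onto x' x x; rewrite -e.
have /lfunP/(_ 1) := e; rewrite !act_coef1 // eqxx.
by case: eqP => [<- //|_ /eqP]; rewrite eq_sym oner_eq0.
Qed.

(** Let p match the functions of x with those of x'. Expanding [c x z] and [c x' z'] at a product by
    [act_coefM] and comparing coefficients of the independent [c x y] gives the equality of [c y z]
    and [c (p y) z']. *)
Lemma act_coef_div x y z x' y' z' :
  c x y = c x' y' -> c x z = c x' z' -> c y z = c y' z'.
Proof.
move=> eq_y eq_z.
have /fin_all_exists[p pE] := act_coef_onto x' x.
have p_inj : injective p by move=> v w e; apply: (@act_coef_inj x); rewrite -!pE e.
have -> : y' = p y by apply: (@act_coef_inj x'); rewrite pE.
apply/lfunP => h; apply/eqP; rewrite -subr_eq0; apply/eqP.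
move: y {eq_y}; apply: (act_coef_free (x := x)) => g.
under eq_bigr => y _ do rewrite mulrBl [_ * c x y g]mulrC [c (p y) _ _ * _]mulrC.
rewrite sumrB -act_coefM // eq_z act_coefM // (reindex_inj p_inj) /=.
by under eq_bigr => y _ do rewrite pE; rewrite subrr.
Qed.

Lemma act_coef_gal (s : 'AHom(L, L)) (q : 'I_n -> 'I_n) :
    (forall x t, emb (q x) t = s (emb x t)) ->
  forall x y x' y', c x y = c x' y' -> c (q x) (q y) = c (q x') (q y').
Proof.
move=> qE.
have q_inj : injective q.
  move=> x y e; apply/emb_inj/val_inj/lfunP => t.
  by have /fmorph_inj : s (emb x t) = s (emb y t) by rewrite -!qE e.
have [r qK rK] := injF_bij q_inj.
(* Applying s to the expansion for x gives an expansion for [q x], and such expansions are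
   unique. *)
have cE x y h : c (q x) (q y) h = s (c x y h).
  suffices e : (fun w => c (q x) w h) =1 (fun w => s (c x (r w) h)) by rewrite e qK.
  apply: emb_coef_uniq => t; rewrite -act_coefP qE act_coefP linear_sum.
  rewrite [RHS](reindex_inj q_inj); apply: eq_bigr => w _ /=.
  by rewrite rmorphM qE qK.
by move=> x y x' y' e; apply/lfunP => h; rewrite !cE e.
Qed.

End Coefficients.

(** * The embeddings in the Galois closure *)

Section ConjugateEmbeddings.
Variables (k : fieldType) (K : fieldExtType k) (L : splittingFieldType k).
Variable iota : 'AHom(K, L).
Hypothesis closK : galois_closure iota.
Local Notation n := (\dim {:K}).
Local Notation G := 'Gal({:L} / 1)%g.

Let gal1 : galois 1 {:L} := closK.1.

Lemma mem_Gal1 (g : gal_of {:L}) : g \in G.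
Proof. by rewrite gal_kHom ?sub1v // k1AHom. Qed.

Lemma card_Gal1 : #|G| = \dim {:L}.
Proof. by rewrite -galois_dim // dimv1 divn1. Qed.

Definition conj_emb (g : gal_of {:L}) : 'AHom(K, L) := (gal_repr g \o iota)%AF.

Lemma conj_embE g t : conj_emb g t = g (iota t).
Proof. by rewrite comp_lfunE. Qed.

Definition conj_embs : seq 'AHom(K, L) :=
  undup (map conj_emb (enum {: gal_of {:L}})).

Lemma mem_conj_embs g : conj_emb g \in conj_embs.
Proof. by rewrite mem_undup map_f ?mem_enum. Qed.

Lemma conj_embsP x : x \in conj_embs -> exists g, x = conj_emb g.
Proof. by rewrite mem_undup => /mapP[g _ ->]; exists g. Qed.

Definition conj_emb_index g : 'I_(size conj_embs) :=
  Ordinal (etrans (index_mem _ _) (mem_conj_embs g)).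

Lemma nth_conj_emb_index g : nth iota conj_embs (conj_emb_index g) = conj_emb g.
Proof. exact/nth_index/mem_conj_embs. Qed.

Lemma mem_Gal_img (g : gal_of {:L}) :
  reflect (forall t, g (iota t) = iota t) (g \in 'Gal({:L} / limg iota)%g).
Proof.
apply: (iffP idP) => [gG t | gid].
  by rewrite (fixed_gal (subvf _) gG) // memv_img ?memvf.
rewrite (@gal_kHom _ _ (iota @: {:K})%AS) ?subvf //; apply/kAHomP => _ /memv_imgP[t _ ->].
exact: gid.
Qed.

(** Two automorphisms restrict to the same embedding exactly when they lie in one right coset of the
    group fixing the image of K, so the count is the index of that group. *)
Lemma size_conj_embs : size conj_embs = n.
Proof.
have dim_img : \dim (limg iota) = n.
  by rewrite limg_dim_eq // (eqP (AHom_lker0 iota)) capv0.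
pose G' := 'Gal({:L} / limg iota)%G.
have cardG' : #|G'| = (\dim {:L} %/ n)%N.
  rewrite -dim_img -(@galois_dim _ _ (iota @: {:K})%AS) //.
  by apply: galoisS gal1; rewrite sub1v subvf.
have dvdn_dim : (n %| \dim {:L})%N.
  by rewrite -dim_img (@field_dimS _ _ (iota @: {:K})%AS) ?subvf.
have : #|G| = (size conj_embs * #|G'|)%N.
  rewrite -[size _]card_ord -sum_nat_const -sum1_card.
  rewrite (partition_big conj_emb_index predT) //=; apply: eq_bigr => i _.
  have [g0 eg0] := conj_embsP (mem_nth iota (ltn_ord i)).
  rewrite sum1dep_card -(card_rcoset G' g0); apply: eq_card => g.
  rewrite inE mem_Gal1 mem_rcoset /=; apply/eqP/mem_Gal_img => [ei t | gid].
    have : conj_emb g = conj_emb g0 by rewrite -eg0 -ei nth_conj_emb_index.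
    move=> /(congr1 (fun f : 'AHom(K, L) => f t)); rewrite !conj_embE => e.
    by rewrite galM ?memvf // e -galM ?memvf // mulgV gal_id.
  apply/val_inj/eqP.
  rewrite -(nth_uniq iota (ltn_ord _) (ltn_ord i) (undup_uniq _)).
  rewrite nth_conj_emb_index eg0; apply/eqP/val_inj/lfunP => t.
  rewrite !comp_lfunE.
  by rewrite -[in RHS](gid t) -galM ?memvf // mulgVK.
rewrite cardG' card_Gal1 => e.
have n_gt0 : (0 < n)%N by apply: adim_gt0.
have D_gt0 : (0 < \dim {:L} %/ n)%N by rewrite divn_gt0 // dvdn_leq // adim_gt0.
by apply/eqP; rewrite -(eqn_pmul2r D_gt0) -e mulnC divnK.
Qed.

Definition emb (i : 'I_n) : 'AHom(K, L) := nth iota conj_embs i.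

Lemma emb_inj : injective emb.
Proof.
move=> i j /eqP; rewrite nth_uniq ?size_conj_embs ?undup_uniq // => /eqP.
exact: val_inj.
Qed.

Lemma embP i : exists g, emb i = conj_emb g.
Proof. by apply/conj_embsP/mem_nth; rewrite size_conj_embs. Qed.

Lemma emb_ex g : exists i, emb i = conj_emb g.
Proof.
have lt_g : (index (conj_emb g) conj_embs < n)%N.
  by rewrite -size_conj_embs index_mem mem_conj_embs.
by exists (Ordinal lt_g); rewrite /emb nth_index ?mem_conj_embs.
Qed.

Lemma gal_emb_ex (g : gal_of {:L}) i : exists j, emb j == (gal_repr g \o emb i)%AF.
Proof.
have [h eh] := embP i; have [j ej] := emb_ex (h * g)%g.
exists j; rewrite ej eh; apply/eqP/val_inj/lfunP => t.
by rewrite !comp_lfunE galM ?memvf.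
Qed.

Definition gal_emb_fun g i := xchoose (gal_emb_ex g i).

Lemma gal_emb_funE g i t : emb (gal_emb_fun g i) t = g (emb i t).
Proof. by rewrite (eqP (xchooseP (gal_emb_ex g i))) comp_lfunE. Qed.

Lemma gal_emb_fun_inj g : injective (gal_emb_fun g).
Proof.
move=> i j e; apply/emb_inj/val_inj/lfunP => t.
have : g (emb i t) = g (emb j t) by rewrite -!gal_emb_funE e.
by move/fmorph_inj.
Qed.

Definition gal_emb g : {perm 'I_n} := perm (@gal_emb_fun_inj g).

Lemma gal_embE g i t : emb (gal_emb g i) t = g (emb i t).
Proof. by rewrite permE gal_emb_funE. Qed.

Lemma gal_emb_morphM : {in G &, {morph gal_emb : g h / (g * h)%g}}.
Proof.
move=> g h _ _; apply/permP => i; apply/emb_inj/val_inj/lfunP => t.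
by rewrite permM !gal_embE galM ?memvf.
Qed.
Canonical gal_emb_morphism := Morphism gal_emb_morphM.

Lemma gal_emb_trans : [transitive gal_emb @* G, on setT | 'P].
Proof.
have [i0 ei0] := emb_ex 1%g.
apply/imsetP; exists i0; rewrite ?inE //; apply/setP => j; rewrite inE.
symmetry; apply/orbitP; have [g eg] := embP j.
exists (gal_emb g); first by rewrite mem_morphim ?mem_Gal1.
apply/emb_inj/val_inj/lfunP => t; rewrite /= gal_embE ei0 eg !conj_embE.
by rewrite gal_id.
Qed.

(** The fixed field of the normal subgroup ['ker gal_emb] is Galois over k and contains the image of
    K; by minimality of the closure it is all of L. *)
Lemma gal_emb_injm : ('injm gal_emb)%g.
Proof.
pose M := fixedField ('ker gal_emb)%g.
have galoisM : galois 1 M by apply: (normal_fixedField_galois gal1); apply: ker_normal.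
have iotaM : (limg iota <= M)%VS.
  apply/subvP => _ /memv_imgP[t _ ->]; apply/fixedFieldP => [|g /mker e].
    exact: memvf.
  have [i ei] := emb_ex 1%g.
  have := gal_embE g i t; rewrite e perm1 ei conj_embE gal_id.
  by move/esym.
have ME : M = {:L}%VS := congr1 (@asval _ _) (closK.2 _ iotaM galoisM).
apply: subset_trans (galois_connection_subset _) _; rewrite -/M ME.
apply/subsetP => g gM; rewrite inE; apply/gal_eqP => a aL.
by rewrite gal_id (fixed_gal _ gM).
Qed.

End ConjugateEmbeddings.

(** * Hopf Galois extensions and their permutation groups *)

Lemma hopf_galois_regular (k : fieldType) (K : fieldExtType k)
    (L : splittingFieldType k) (iota : 'AHom(K, L)) (closK : galois_closure iota) :
  hopf_galois K ->
  exists N : {group {perm 'I_(\dim {:K})}},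
    [/\ [transitive N, on setT | 'P], forall i, ('C_N[i | 'P] = 1)%g
      & gal_emb closK @* 'Gal({:L} / 1) \subset 'N(N)]%g.
Proof.
case=> H [hopfH [act [_ modH gal_bij]]].
have [i0 _] := emb_ex closK 1%g.
have e_inj := emb_inj closK.
pose c := act_coef (emb iota) act.
have c_onto : forall x x' y', exists y, c x y = c x' y' by apply: act_coef_onto modH _.
have c_inj : forall x, injective (c x) by apply: act_coef_inj.
have c_diag : forall x y, c x x = c y y by apply: act_coef_diag modH _.
have c_div : forall x y z x' y' z',
    c x y = c x' y' -> c x z = c x' z' -> c y z = c y' z'.
  by apply: act_coef_div modH _.
exists (Group (stable_perms_group c_diag c_div)); split.
- exact: (stable_perms_trans c_onto c_inj c_diag c_div i0).
- exact: stable_perms_stab.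
apply/subsetP => _ /morphimP[g _ _ ->].
apply: stable_perms_norm; apply: (act_coef_gal e_inj (s := gal_repr g)) => i t.
exact: gal_embE.
Qed.

Lemma hopf_galois_six (k : fieldType) (K : fieldExtType k)
    (L : splittingFieldType k) (iota : 'AHom(K, L)) :
    galois_closure iota -> \dim {:K} = 6%N -> hopf_galois K ->
  (exists2 H : {group gal_of {:L}},
     H \subset 'Gal({:L} / 1) & #|'Gal({:L} / 1) : H| = 2%N)%g
  /\ (\dim {:L} %| 36)%N.
Proof.
move=> closK degK /(hopf_galois_regular closK)[N [N_trans N_stab nNG]].
have cardX : #|'I_(\dim {:K})| = 6%N by rewrite card_ord.
have f_inj := gal_emb_injm closK.
have [[H sH iH] dvd36] :=
  regular_six_normalizer cardX N_trans N_stab (gal_emb_trans closK) nNG.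
split; last by rewrite -(card_Gal1 closK) -(card_injm f_inj).
(* The index 2 subgroup of the permutation image is pulled back along the faithful action. *)
have sf : (gal_emb_morphism closK @*^-1 H \subset 'Gal({:L} / 1))%g.
  by rewrite morphpreE subsetIl.
exists (gal_emb_morphism closK @*^-1 H)%G => //.
by rewrite -iH -[in RHS](morphpreK sH) index_injm.
Qed.

Theorem proposition4p1 (k : fieldType) (K : fieldExtType k)
    (Kt : splittingFieldType k) (iota : 'AHom(K, Kt))
    (sepK : separable 1 {:K}) (degK : \dim {:K} = 6%N)
    (closK : galois_closure iota) :
  ((\dim {:Kt} = 24 \/ 36 < \dim {:Kt})%N -> ~ hopf_galois K) /\
  ('Gal({:Kt} / 1) \isog 'Alt_('I_4) -> ~ hopf_galois K).
Proof.
split=> [dimKt | /isogP[f f_inj fG]] /(hopf_galois_six closK degK)[[H sH iH] dvd36].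
  by case: dimKt => [e|]; [rewrite e in dvd36 | rewrite ltnNge dvdn_leq].
have sfH : (f @* H \subset 'Alt_('I_4))%g by rewrite -fG morphimS.
by have /eqP[] := index2_Alt4 sfH; rewrite -fG index_injm.
Qed.
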